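(* Let $X$ be a nonempty set. The following conditions are equivalent for every mapping $\Phi$ with the domain $X^{2}$: (i) $\Phi$ is combinatorially similar to a Ptolemaic metric. (ii) $\Phi$ is combinatorially similar to a metric. (iii) $\Phi$ is combinatorially similar to a semimetric. (iv) $\Phi$ is symmetric, $|\Phi(X^2)| \leqslant \mathfrak{c}$ holds, and there is $a_0 \in \Phi(X^{2})$ such that $\Phi^{-1}(a_0) = \Delta_X$, where $\Delta_X=\{\langle x,x\rangle : x\in X\}$ is the diagonal on $X$.
   Context: $\mathfrak{c}$ is the cardinality of the continuum. A mapping $\Phi$ with domain $X^2$ may take values in an arbitrary set; $\Phi(X^2)$ is its image and $\Phi^{-1}(a)=\{\langle x,y\rangle\in X^2:\Phi(x,y)=a\}$. It is symmetric if $\Phi(x,y)=\Phi(y,x)$ for all $x,y\in X$. A semimetric on a set $Y$ is a nonnegative function $d\colon Y^2\to\mathbb{R}$ such that $d(x,y)=d(y,x)$ and $d(x,y)=0\Leftrightarrow x=y$ for all $x,y\in Y$; a metric is a semimetric satisfying the triangle inequality. A metric $d$ on $Y$ is Ptolemaic if $d(x,z)d(y,t)+d(x,t)d(y,z)\geqslant d(x,y)d(z,t)$ for all $x,y,z,t\in Y$. A mapping $\Phi$ with domain $X^2$ is combinatorially similar to a mapping $\Psi$ with domain $Y^2$ if there are bijections $f\colon\Phi(X^2)\to\Psi(Y^2)$ and $g\colon Y\to X$ such that $\Psi(x,y)=f(\Phi(g(x),g(y)))$ for all $x,y\in Y$. In (i)–(iii) the (Ptolemaic) metric or semimetric is on some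 set $Y$. *)

(* Defs.v *)
From mathcomp Require Import all_boot all_order all_algebra.
From mathcomp Require Import boolp classical_sets functions cardinality reals.

Set Implicit Arguments.
Unset Strict Implicit.
Unset Printing Implicit Defensive.

Import Order.TTheory GRing.Theory Num.Theory.

Local Open Scope classical_set_scope.
Local Open Scope ring_scope.

Definition symmetric_map (X V : Type) (Phi : X * X -> V) : Prop :=
  forall x y : X, Phi (x, y) = Phi (y, x).

Definition is_semimetric (R : realType) (Y : Type) (d : Y * Y -> R) : Prop :=
  [/\ forall x y : Y, 0 <= d (x, y),
      symmetric_map d
    & forall x y : Y, d (x, y) = 0 <-> x = y].

Definition is_metric (R : realType) (Y : Type) (d : Y * Y -> R) : Prop :=
  is_semimetric d /\
  forall x y z : Y, d (x, y) <= d (x, z) + d (z, y).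

Definition is_ptolemaic_metric (R : realType) (Y : Type) (d : Y * Y -> R) :
    Prop :=
  is_metric d /\
  forall x y z t : Y,
    d (x, z) * d (y, t) + d (x, t) * d (y, z) >= d (x, y) * d (z, t).

(* The bijection f between the images is represented by a total function
   V -> W that restricts to a bijection between the two ranges; its values
   outside range Phi are irrelevant. No generality is lost for nonempty X,
   since W is then inhabited. *)
Definition combinatorially_similar (X V Y W : Type)
    (Phi : X * X -> V) (Psi : Y * Y -> W) : Prop :=
  exists (f : V -> W) (g : Y -> X),
    [/\ set_bij (range Phi) (range Psi) f,
        bijective g
      & forall x y : Y, Psi (x, y) = f (Phi (g x, g y))].

(* Main.v *)
(* In (iv) => (i), nonzero distances confined to [1, sqrt 2] force both the
   triangle and the Ptolemaic inequality: products of two of them lie in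
   [1, 2], and the degenerate quadruples are equalities or trivial.  Since R
   embeds into [1, sqrt 2], relabelling the off-diagonal values of Phi by such
   an injection, and a0 by 0, gives the required metric on X itself. *)
Require Import Defs.
From mathcomp Require Import all_boot all_order all_algebra.
From mathcomp Require Import boolp classical_sets functions cardinality reals.
From mathcomp Require Import constructive_ereal lra.

Import Order.TTheory GRing.Theory Num.Theory.

Local Open Scope classical_set_scope.
Local Open Scope ring_scope.

(** Bounding the square by 2 expresses the upper end of the range without a square root. *)
Lemma ptolemaic_metric_of_narrow_range {R : realType} {Y : Type}
    {d : Y * Y -> R} :
  symmetric_map d -> (forall x, d (x, x) = 0) ->
  (forall x y, x <> y -> 1 <= d (x, y) /\ d (x, y) ^+ 2 <= 2) ->
  is_ptolemaic_metric d.
Proof.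
move=> dC dxx dneq.
have d_ge0 x y : 0 <= d (x, y).
  have [->|/dneq[dxy _]] := pselect (x = y); first by rewrite dxx.
  exact: le_trans dxy.
have d_eq0 x y : d (x, y) = 0 <-> x = y.
  split=> [dxy0|->//]; apply: contrapT => /dneq[]; rewrite dxy0.
  by rewrite ler10.
split; [split; first by split|].
- move=> x y z.
  have [->|/dneq[dxy dxy2]] := pselect (x = y).
    by rewrite dxx addr_ge0.
  have [<-|/dneq[dxz _]] := pselect (x = z); first by rewrite dxx add0r.
  have [->|/dneq[dzy _]] := pselect (z = y); first by rewrite dxx addr0.
  (* A distance above 2 would have square above 4, while the two distances on the right sum to at
     least 2. *)
  nra.
- move=> x y z t.
  have [->|/dneq[_ dxy]] := pselect (x = y).
    by rewrite dxx mul0r addr_ge0 ?mulr_ge0.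
  have [->|/dneq[_ dzt]] := pselect (z = t).
    by rewrite dxx mulr0 addr_ge0 ?mulr_ge0.
  (* If one of [x], [y] meets one of [z], [t], one product of the sum vanishes and the other is
     [d (x, y) * d (z, t)] up to symmetry. *)
  have [->|/dneq[dxz _]] := pselect (x = z).
    by rewrite dxx mul0r add0r mulrC (dC z y).
  have [->|/dneq[dyt _]] := pselect (y = t).
    by rewrite dxx mulr0 add0r (dC z t).
  have [->|/dneq[dxt _]] := pselect (x = t).
    by rewrite dxx mul0r addr0 mulrC (dC z t) (dC t y).
  have [->|/dneq[dyz _]] := pselect (y = z).
    by rewrite dxx mulr0 addr0.
  (* With a and b the two factors, 2ab <= a^2 + b^2 <= 4. *)
  have le2 : d (x, y) * d (z, t) <= 2.
    have := sqr_ge0 (d (x, y) - d (z, t)); nra.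
  apply: (le_trans le2).
  by rewrite -[2]/(1 + 1) lerD // -[leLHS]mulr1 ler_pM.
Qed.

Lemma ex_injection_narrow_range (R : realType) :
  exists2 e : R -> R, injective e & forall x, 1 <= e x /\ e x ^+ 2 <= 2.
Proof.
(* [contract] is injective with values in [-1, 1], so this map lands in [1, 7/5], and 49/25 < 2. *)
exists (fun x => (6 + contract x%:E) / 5) => [x y|x].
  move=> e_eq; have /contract_inj[] // : contract x%:E = contract y%:E.
  lra.
have := contract_le1 x%:E; rewrite ler_norml => /andP[].
by set c := contract _ => ? ?; split; nra.
Qed.

(* [pcard_injP] wants a [pointedType], which an abstract [realType] is not. *)
Lemma card_le_setT_injP {T U : Type} (u : U) {A : set T} :
  reflect (exists f : T -> U, {in A &, injective f}) (A #<= [set: U])%card.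
Proof.
elim/Ppointed: U => U in u *; last exact: pcard_injP.
by have : [set: U] u by []; rewrite emptyE.
Qed.

Theorem corollary3p3 (R : realType) (X : Type) (hX : [set: X] !=set0)
    (V : Type) (Phi : X * X -> V) :
  [<-> exists (Y : Type) (d : Y * Y -> R),
         is_ptolemaic_metric d /\ combinatorially_similar Phi d;
       exists (Y : Type) (d : Y * Y -> R),
         is_metric d /\ combinatorially_similar Phi d;
       exists (Y : Type) (d : Y * Y -> R),
         is_semimetric d /\ combinatorially_similar Phi d;
       [/\ symmetric_map Phi,
           (range Phi #<= [set: R])%card
         & exists2 a0 : V, range Phi a0 & Phi @^-1` [set a0] = diagonal]].
Proof.
tfae.
- by move=> [Y [d [[dM _] sim]]]; exists Y, d.
- by move=> [Y [d [[dM _] sim]]]; exists Y, d.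
- move=> [Y [d [[_ dC d_eq0] [f [g [[_ f_inj _] [h gK hK] dE]]]]]].
  have fE x y : f (Phi (x, y)) = d (h x, h y) by rewrite dE !hK.
  (* [f] is injective only on [range Phi], so it is cancelled only between values of [Phi]. *)
  have PhiI p q : f (Phi p) = f (Phi q) -> Phi p = Phi q.
    by move=> /f_inj; apply; apply/mem_set; [exists p|exists q].
  split.
  + by move=> x y; apply: PhiI; rewrite !fE dC.
  + by apply/(card_le_setT_injP 0); exists f.
  (* Any diagonal value serves as [a0]: [f] sends all of them to 0, hence they coincide. *)
  + have [x0 _] := hX; exists (Phi (x0, x0)); first by exists (x0, x0).
    have f0 : f (Phi (x0, x0)) = 0 by rewrite fE; apply/d_eq0.
    apply/seteqP; split=> [[x y]|[x y]] /=.
    * move=> /(congr1 f); rewrite f0 fE => /d_eq0 hxy.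
      exact: (can_inj hK).
    * by rewrite /diagonal /= => ->; apply: PhiI; rewrite f0 fE; apply/d_eq0.
- move=> [PhiC /(card_le_setT_injP 0)[i i_inj] [a0 _ Phia0]].
  have PhiE x y : Phi (x, y) = a0 <-> x = y.
    by rewrite -(diagonalP x y) -Phia0.
  have [e e_inj e_range] := ex_injection_narrow_range R.
  (* Values of [e] are at least 1, so 0 is free to encode [a0] without spoiling injectivity on
     [range Phi]. *)
  pose f v : R := if pselect (v = a0) then 0 else e (i v).
  have f0 : f a0 = 0 by rewrite /f; case: pselect.
  have fN v : v <> a0 -> f v = e (i v) by rewrite /f; case: pselect.
  have f_neq0 v : v <> a0 -> f v <> 0.
    by move=> /fN-> e0; have [] := e_range (i v); rewrite e0 ler10.
  exists X, (f \o Phi); split.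
    apply: ptolemaic_metric_of_narrow_range => [x y|x|x y xy] /=.
    * by rewrite PhiC.
    * by rewrite (PhiE x x).2.
    * by rewrite fN // => /PhiE.
  exists f, id; split=> //; last exact: inv_bij.
  split.
  + by move=> _ [p _ <-]; exists p.
  + move=> u v uP vP.
    have [->|ua0] := pselect (u = a0); have [->|va0] := pselect (v = a0) => //.
    * by rewrite f0 => /esym/(f_neq0 _ va0).
    * by rewrite f0 => /(f_neq0 _ ua0).
    * by rewrite !fN // => /e_inj/(i_inj _ _ uP vP).
  + by move=> _ [p _ <-]; exists (Phi p) => //; exists p.
Qed.
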